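(* Let $n\ge3$, let $\mathrm{wt}_n:[n]\times[n]\to\mathbb{R}$ be any function, and let $X_n^{wt}=\sum_{i,j\in[n],\,i<j}\mathrm{wt}_n(i,j)\operatorname{inv}_{ij}$. Set $\alpha=\sum_{i,j\in[n],\,i<j}\mathrm{wt}_n(i,j)$ and $\beta=\sum_{i,j\in[n],\,i<j}(j-i-1)\mathrm{wt}_n(i,j)$. Then for every conjugacy class $C_{\lambda,\mu}$ of $B_n$, $\mathbb{E}_{\lambda,\mu}[X_n^{wt}]$ depends only on $n$, $m_1(\lambda)$, $m_1(\mu)$, and equals \[\frac{\alpha}{2}\left(1+\frac{\Delta^1(\lambda,\mu)-\Delta^2(\lambda,\mu)}{n(n-1)}\right)-\frac{\beta}{2(n-2)}\left(\frac{\Delta^1(\lambda,\mu)}{n-1}-\frac{\Delta^2(\lambda,\mu)}{n(n-1)}\right).\] Moreover $\mathbb{E}_{B_n}[X_n^{wt}]=\alpha/2$, and $\mathbb{E}_{\lambda,\mu}[X_n^{wt}]=\mathbb{E}_{B_n}[X_n^{wt}]+f_n(m_1(\lambda),m_1(\mu))$, where $f_n(a_1,b_1)$ is a polynomial of degree at most $2$ in the two variables $a_1,b_1$ satisfying $\sum_{(\lambda,\mu)}z_{\lambda,\mu}^{-1}f_n(m_1(\lambda),m_1(\mu))=0$, the sum ranging over all bi-partitions $(\lambda,\mu)$ of $n$.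
   Context: $B_n$ is the group of permutations $\omega$ of $\{\pm1,\dots,\pm n\}$ with $\omega(-i)=-\omega(i)$. A cycle of $\omega$ is a cycle of $|\omega|:i\mapsto|\omega(i)|$; it is even (odd) if the number of its elements $i$ with $\omega(i)<0$ is even (odd). The cycle type is the bi-partition $(\lambda,\mu)$ (pair of partitions with total size $n$) with $\lambda$ the lengths of even cycles and $\mu$ the lengths of odd cycles; $C_{\lambda,\mu}$ is the conjugacy class of elements of this type, $\mathbb{E}_{\lambda,\mu}$ and $\mathbb{E}_{B_n}$ are expectations under the uniform distributions on $C_{\lambda,\mu}$ and $B_n$. $m_i(\lambda)$ is the number of parts of $\lambda$ equal to $i$, $\ell(\lambda)=\sum_i m_i(\lambda)$, $z_\lambda=\prod_i i^{m_i(\lambda)}m_i(\lambda)!$, $z_{\lambda,\mu}=2^{\ell(\lambda)}z_\lambda2^{\ell(\mu)}z_\mu$, and $\Delta^k(\lambda,\mu)=m_1(\lambda)^k-m_1(\mu)^k$. For $i<j$ in $[n]$, $\operatorname{inv}_{ij}$ is the indicator that $\omega(i)>\omega(j)$. *)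

(* Defs.v *)
From HB Require Import structures.
From mathcomp Require Import all_boot all_order all_algebra all_fingroup.
From mathcomp Require Import mpoly.
From mathcomp Require Import reals.

Set Implicit Arguments.
Unset Strict Implicit.
Unset Printing Implicit Defensive.

Import Order.TTheory GRing.Theory Num.Theory.
Local Open Scope ring_scope.

(* {±1, ..., ±n}: the pair (b, i) stands for the integer (-1)^b * (i + 1), so
   [n] is represented by 'I_n with the usual shift, and b = true means < 0. *)
Definition signed (n : nat) : finType := (bool * 'I_n)%type.

Definition spos {n : nat} (i : 'I_n) : signed n := (false, i).

Definition sopp {n : nat} (x : signed n) : signed n := (~~ x.1, x.2).

Definition sint {n : nat} (x : signed n) : int := (-1) ^+ x.1 * (x.2.+1)%:Z.

Definition Bset (n : nat) : {set {perm signed n}} :=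
  [set w : {perm signed n} | [forall x, w (sopp x) == sopp (w x)]].

Lemma Bset_group_set (n : nat) : group_set (Bset n).
Proof.
apply/group_setP; split.
  by rewrite inE; apply/forallP => x; rewrite !perm1.
move=> u v; rewrite !inE => /forallP hu /forallP hv; apply/forallP => x.
by rewrite !permM (eqP (hu x)) (eqP (hv _)).
Qed.

Canonical Bgroup (n : nat) : {group {perm signed n}} := Group (Bset_group_set n).

(* |w| : i |-> |w(i)| on [n]; it is a bijection when w lies in B_n, and then its
   orbits are its cycles (fixed points included). *)
Definition absfun {n : nat} (w : {perm signed n}) (i : 'I_n) : 'I_n :=
  (w (spos i)).2.

Definition cycles {n : nat} (w : {perm signed n}) : {set {set 'I_n}} :=
  [set [set j in fingraph.orbit (absfun w) i] | i : 'I_n].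

Definition odd_cycle {n : nat} (w : {perm signed n}) (c : {set 'I_n}) : bool :=
  odd #|[set i in c | (sint (w (spos i)) < 0)%R]|.

Definition cycle_type {n : nat} (w : {perm signed n}) : seq nat * seq nat :=
  (sort geq [seq #|c| | c : {set 'I_n} in [set c in cycles w | ~~ odd_cycle w c]],
   sort geq [seq #|c| | c : {set 'I_n} in [set c in cycles w | odd_cycle w c]]).

Definition is_partition (s : seq nat) : bool := sorted geq s && (0%N \notin s).

(* The parts of a bi-partition of n are at most n in size and in number, so
   bounded sequences over 'I_n.+1 lose nothing and give a finite type. *)
Definition parts {n : nat} (s : n.-bseq 'I_n.+1) : seq nat :=
  [seq nat_of_ord i | i <- s].

Definition is_bipartition {n : nat}
    (p : n.-bseq 'I_n.+1 * n.-bseq 'I_n.+1) : bool :=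
  [&& is_partition (parts p.1), is_partition (parts p.2)
    & (sumn (parts p.1) + sumn (parts p.2) == n)%N].

Definition bipartition (n : nat) : finType :=
  {p : n.-bseq 'I_n.+1 * n.-bseq 'I_n.+1 | is_bipartition p}.

Definition bpl {n : nat} (p : bipartition n) : seq nat := parts (val p).1.
Definition bpr {n : nat} (p : bipartition n) : seq nat := parts (val p).2.

Definition Cclass {n : nat} (p : bipartition n) : {set {perm signed n}} :=
  [set w in Bset n | cycle_type w == (bpl p, bpr p)].

Definition nparts (i : nat) (s : seq nat) : nat := count_mem i s.

(* In the next two definitions all parts of s are at most sumn s. *)
Definition len (s : seq nat) : nat :=
  (\sum_(1 <= i < (sumn s).+1) nparts i s)%N.

Definition zpart (s : seq nat) : nat :=
  (\prod_(1 <= i < (sumn s).+1) (i ^ nparts i s * (nparts i s)`!))%N.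

Definition zbipart {n : nat} (p : bipartition n) : nat :=
  (2 ^ len (bpl p) * zpart (bpl p) * 2 ^ len (bpr p) * zpart (bpr p))%N.

Definition Delta (R : realType) {n : nat} (k : nat) (p : bipartition n) : R :=
  (nparts 1 (bpl p))%:R ^+ k - (nparts 1 (bpr p))%:R ^+ k.

Definition inv_ind {n : nat} (i j : 'I_n) (w : {perm signed n}) : bool :=
  (sint (w (spos j)) < sint (w (spos i)))%R.

Definition Xwt {R : realType} {n : nat} (wt : 'I_n -> 'I_n -> R)
    (w : {perm signed n}) : R :=
  \sum_(i < n) \sum_(j < n | (i < j)%N) wt i j * (inv_ind i j w)%:R.

Definition alphawt {R : realType} {n : nat} (wt : 'I_n -> 'I_n -> R) : R :=
  \sum_(i < n) \sum_(j < n | (i < j)%N) wt i j.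

Definition betawt {R : realType} {n : nat} (wt : 'I_n -> 'I_n -> R) : R :=
  \sum_(i < n) \sum_(j < n | (i < j)%N) (j%:R - i%:R - 1) * wt i j.

Definition expect_unif {R : realType} {T : finType} (A : {set T}) (X : T -> R) : R :=
  (\sum_(w in A) X w) / #|A|%:R.

Definition pt2 {R : realType} (a b : R) : 'I_2 -> R := tnth [tuple a; b].

(* Main.v *)
Require Import Defs.
From HB Require Import structures.
From mathcomp Require Import all_boot all_order all_algebra all_fingroup.
From mathcomp Require Import mpoly.
From mathcomp Require Import reals.
From mathcomp Require Import zify ring.

Set Implicit Arguments.
Unset Strict Implicit.
Unset Printing Implicit Defensive.

Import Order.TTheory GRing.Theory Num.Theory.
Local Open Scope ring_scope.

(* For i < j, inv_ij - 1/2 is half the sign of w i - w j, which is the sign of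
   whichever of w i, - w j is larger in absolute value.  Averaging over a class
   invariant under conjugation by single sign changes kills this sign unless it
   comes from a fixed point of |w|.  The remaining averages of
   (sign of w at a fixed i) * [|w| j = k] depend, by conjugation by permutations,
   only on whether j = k, and are determined by m_1(lambda), m_1(mu) through double
   counting.  The resulting f_n is antisymmetric in its two variables while
   z_{lambda,mu} is symmetric, so exchanging lambda and mu shows that the weighted
   sum of f_n vanishes.  Class averages are junk on an empty class, so each cycle
   type also has to be realized by an element of B_n. *)

(** * Signs and absolute values of the elements of [Bset n] *)

Definition psign {n : nat} (w : {perm signed n}) (i : 'I_n) : bool :=
  (w (spos i)).1.

Lemma perm_spos n (w : {perm signed n}) i : w (spos i) = (psign w i, absfun w i).
Proof. by rewrite /psign /absfun -surjective_pairing. Qed.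

(** Commuting with [sopp] means that the sign of the argument is added to that of the image, so [w]
    is determined by [psign w] and [absfun w]. *)
Lemma BsetP n (w : {perm signed n}) :
  reflect (forall b i, w (b, i) = (b (+) psign w i, absfun w i)) (w \in Bset n).
Proof.
rewrite inE; apply: (iffP forallP) => [wN [] i | wE [b i]].
- by have /eqP := wN (spos i); rewrite perm_spos => ->.
- by rewrite [LHS]perm_spos.
- by rewrite /sopp /= !wE addNb.
Qed.

Lemma absfun_inj n (w : {perm signed n}) : w \in Bset n -> injective (absfun w).
Proof.
move=> /BsetP wE i j eq_ij.
have /perm_inj[] // : w (psign w i, i) = w (psign w j, j).
by rewrite !wE !addbb eq_ij.
Qed.

Lemma sint_lt0 n (x : signed n) : (sint x < 0) = x.1.
Proof. by case: x => -[] i; rewrite /sint /= ?expr1 ?expr0 ?mulN1r ?mul1r. Qed.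

(** When the absolute values differ, the larger one decides the comparison, and only its sign
    matters. *)
Lemma sint_lt n (x y : signed n) : x.2 != y.2 ->
  (sint y < sint x) = if (y.2 < x.2)%N then ~~ x.1 else y.1.
Proof.
case: x y => b i [c j] /= ij; rewrite /sint /=.
have {}ij : (i != j :> nat) by [].
by case: b; case: c; rewrite ?expr1 ?expr0 ?mulN1r ?mul1r ?ltrN2 ?ltz_nat ?ltnS;
  case: ltngtP ij => //= ? _; lia.
Qed.

(** * Invariance of the cycle type under conjugation in B_n *)

Section Conjugation.
Variables (n : nat) (w g : {perm signed n}).
Hypotheses (wB : w \in Bset n) (gB : g \in Bset n).

(** Evaluating at the image of [i] under [g] keeps the inverse of [g] out of the formula. *)
Lemma permJ_absfun i :
  (w ^ g)%g (spos (absfun g i)) =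
  (psign g i (+) psign w i (+) psign g (absfun w i),
   absfun g (absfun w i)).
Proof.
have -> : spos (absfun g i) = g (psign g i, i).
  by rewrite (BsetP _ gB) addbb.
by rewrite permJ (BsetP _ wB) (BsetP _ gB).
Qed.

Lemma absfunJ i : absfun (w ^ g)%g (absfun g i) = absfun g (absfun w i).
Proof. by rewrite {1}/absfun permJ_absfun. Qed.

Lemma psignJ i : psign (w ^ g)%g (absfun g i) =
  psign g i (+) psign w i (+) psign g (absfun w i).
Proof. by rewrite {1}/psign permJ_absfun. Qed.

Lemma orbitJ i : [set j in fingraph.orbit (absfun (w ^ g)%g) (absfun g i)] =
  absfun g @: [set j in fingraph.orbit (absfun w) i].
Proof.
have iterJ k : iter k (absfun (w ^ g)%g) (absfun g i) = absfun g (iter k (absfun w) i).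
  by elim: k => //= k ->; rewrite absfunJ.
apply/setP => j; rewrite inE -fconnect_orbit.
apply/idP/imsetP => [/iter_findex <- | [k]].
  by rewrite iterJ; exists (iter (findex (absfun (w ^ g)%g) (absfun g i) j) (absfun w) i);
    rewrite // inE -fconnect_orbit fconnect_iter.
by rewrite inE -fconnect_orbit => /iter_findex <- ->; rewrite -iterJ fconnect_iter.
Qed.

Lemma cyclesJ : cycles (w ^ g)%g = [set absfun g @: c | c : {set 'I_n} in cycles w].
Proof.
have [g' _ Kg] := injF_bij (absfun_inj gB).
apply/setP => c; apply/imsetP/imsetP => [[i _ ->] | [_ /imsetP[i _ ->] ->]].
  by exists [set j in fingraph.orbit (absfun w) (g' i)]; [exact: imset_f|rewrite -orbitJ Kg].
by exists (absfun g i); rewrite ?orbitJ.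
Qed.

End Conjugation.

(** Parity written as an iterated exclusive or can be split and reindexed along a cycle. *)
Lemma odd_card_addb (T : finType) (A : {set T}) (P : pred T) :
  odd #|[set i in A | P i]| = \big[addb/false]_(i in A) P i.
Proof.
rewrite -sum1dep_card (big_morph odd oddD (erefl _)) big_mkcondr /=.
by apply: eq_bigr => i _; case: (P i).
Qed.

Lemma odd_cycleE n (w : {perm signed n}) (c : {set 'I_n}) :
  odd_cycle w c = \big[addb/false]_(i in c) psign w i.
Proof. by rewrite -odd_card_addb; congr odd; apply: eq_card => i; rewrite !inE sint_lt0. Qed.

Lemma cycles_stable n (w : {perm signed n}) c : w \in Bset n -> c \in cycles w ->
  absfun w @: c = c.
Proof.
move=> wB /imsetP[i _ ->]; apply/eqP.
rewrite eqEcard card_imset ?leqnn ?andbT; last exact: absfun_inj.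
apply/subsetP => _ /imsetP[j + ->]; rewrite !inE -!fconnect_orbit => ij.
exact: connect_trans ij (fconnect1 _ _).
Qed.

(* The signs contributed by g along the cycle telescope. *)
Lemma odd_cycleJ n (w g : {perm signed n}) c : w \in Bset n -> g \in Bset n ->
  c \in cycles w -> odd_cycle (w ^ g)%g (absfun g @: c) = odd_cycle w c.
Proof.
move=> wB gB cw; rewrite !odd_cycleE big_imset /=; last exact: in2W (absfun_inj gB).
under eq_bigr do rewrite psignJ //.
rewrite !big_split /=.
have <- : \big[addb/false]_(i in c) psign g i =
          \big[addb/false]_(i in c) psign g (absfun w i).
  by rewrite -{1}(cycles_stable wB cw) big_imset //=; apply: in2W (absfun_inj wB).
by rewrite addbAC addbb.
Qed.

Lemma perm_sort_geq (s t : seq nat) : perm_eq s t -> sort geq s = sort geq t.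
Proof.
by move=> st; apply/perm_sortP => // [a b | a b c | a b] /=; lia.
Qed.

Lemma perm_image_imset (S T : finType) (U : eqType) (h : S -> T) (F : T -> U) (A : {set S}) :
  injective h -> perm_eq [seq F y | y in h @: A] [seq F (h x) | x in A].
Proof.
move=> hI; rewrite /image_mem [X in perm_eq _ X](map_comp F h); apply: perm_map.
apply: uniq_perm; rewrite ?map_inj_uniq ?enum_uniq // => y.
by rewrite mem_enum; apply/imsetP/mapP => -[x xA ->]; exists x; rewrite ?mem_enum // -mem_enum.
Qed.

Lemma cycle_typeJ n (w g : {perm signed n}) : w \in Bset n -> g \in Bset n ->
  cycle_type (w ^ g)%g = cycle_type w.
Proof.
move=> wB gB; have gI := imset_inj (absfun_inj gB).
(* The boolean [b] treats both components at once: [true] selects the even cycles, [false] the odd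
   ones. *)
suff H b : sort geq [seq #|c| | c : {set 'I_n} in
             [set c in cycles (w ^ g)%g | b (+) odd_cycle (w ^ g)%g c]] =
    sort geq [seq #|c| | c : {set 'I_n} in [set c in cycles w | b (+) odd_cycle w c]].
  by rewrite /cycle_type; congr pair; [exact: (H true) | exact: (H false)].
have -> : [set c in cycles (w ^ g)%g | b (+) odd_cycle (w ^ g)%g c] =
  (fun c : {set 'I_n} => absfun g @: c) @: [set c in cycles w | b (+) odd_cycle w c].
  apply/setP => c; rewrite inE cyclesJ //.
  apply/andP/imsetP => [[/imsetP[d dw ->]] | [d]]; rewrite ?inE.
    by rewrite odd_cycleJ // => ob; exists d; rewrite ?inE ?dw.
  by case/andP => dw ob ->; rewrite odd_cycleJ // imset_f.
apply: perm_sort_geq; apply: perm_trans (perm_image_imset _ _ gI) _.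
rewrite (eq_image (B := mem [set c in cycles w | b (+) odd_cycle w c]) (g := fun c : {set 'I_n} => #|c|)) //.
by move=> c; rewrite card_imset //; apply: absfun_inj.
Qed.

Lemma in_Cclass n (p : bipartition n) w :
  (w \in Cclass p) = (w \in Bset n) && (cycle_type w == (bpl p, bpr p)).
Proof. exact: in_set. Qed.

Lemma CclassJ n (p : bipartition n) (w g : {perm signed n}) :
  g \in Bset n -> w \in Cclass p -> (w ^ g)%g \in Cclass p.
Proof.
move=> gB; rewrite !in_Cclass => /andP[wB /eqP ct].
by rewrite cycle_typeJ // ct eqxx andbT (groupJ (G := Bgroup n)).
Qed.

(** * Elements of B_n with prescribed signs and absolute values *)

Definition signed_fun {n : nat} (sg : 'I_n -> bool) (f : 'I_n -> 'I_n)
  (x : signed n) : signed n := (x.1 (+) sg x.2, f x.2).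

Lemma signed_fun_inj n (sg : 'I_n -> bool) (f : 'I_n -> 'I_n) :
  injective f -> injective (signed_fun sg f).
Proof. by move=> fI [b i] [c j] [+ /fI ij]; rewrite {i}ij => /addIb ->. Qed.

Section SignedPerm.
Variables (n : nat) (sg : 'I_n -> bool) (f : 'I_n -> 'I_n) (fI : injective f).

(** Signs and a permutation of [n] can be chosen independently; this supplies both the conjugating
    elements and the representatives of the classes. *)
Definition signed_perm : {perm signed n} := perm (signed_fun_inj (sg := sg) fI).

Lemma absfun_signed_perm i : absfun signed_perm i = f i.
Proof. by rewrite /absfun permE. Qed.

Lemma psign_signed_perm i : psign signed_perm i = sg i.
Proof. by rewrite /psign permE. Qed.

Lemma signed_perm_in : signed_perm \in Bset n.
Proof.
by apply/BsetP => b i; rewrite psign_signed_perm absfun_signed_perm permE.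
Qed.

End SignedPerm.

(** * Fixed points of |w| and the sign form of an inversion *)

Definition nfix {n : nat} (b : bool) (w : {perm signed n}) : nat :=
  #|[set i | (absfun w i == i) && (psign w i == b)]|.

(** Only fixed points of |w| contribute; on a class, the sum over [i] will be m_1(lambda) -
    m_1(mu). *)
Definition fixsign (R : pzRingType) {n : nat} (w : {perm signed n}) (i : 'I_n) : R :=
  (absfun w i == i)%:R * (-1) ^+ psign w i.

Section FixSums.
Variables (R : pzRingType) (n : nat) (w : {perm signed n}).

Lemma sum_fixsign : \sum_i fixsign R w i = (nfix false w)%:R - (nfix true w)%:R.
Proof.
rewrite /nfix -!sum1dep_card !natr_sum [X in X - _]big_mkcond [X in _ - X]big_mkcond -sumrB /=.
by apply: eq_bigr => i _; rewrite /fixsign; case: eqP; case: psign => _ /=;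
  rewrite ?mul0r ?mul1r ?subr0 ?sub0r ?expr0 ?expr1.
Qed.

Lemma sum_fix : \sum_i (absfun w i == i)%:R = (nfix false w)%:R + (nfix true w)%:R :> R.
Proof.
rewrite /nfix -!sum1dep_card !natr_sum [X in X + _]big_mkcond [X in _ + X]big_mkcond -big_split /=.
by apply: eq_bigr => i _; case: eqP; case: psign => _ /=; rewrite ?addr0 ?add0r.
Qed.

Lemma fixsign_fix i : fixsign R w i * (absfun w i == i)%:R = fixsign R w i.
Proof. by rewrite /fixsign; case: eqP => _; rewrite ?mul0r ?mulr1. Qed.

End FixSums.

Lemma sum_eq_lt (R : pzRingType) n (x i : 'I_n) :
  \sum_(k < n | (k < i)%N) (x == k)%:R = (x < i)%N%:R :> R.
Proof.
case: (boolP (x < i)%N) => xi; last first.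
  by rewrite big1 // => k; case: eqP => // <-; rewrite (negPf xi).
rewrite (bigD1 x) //= eqxx big1 ?addr0 // => k /andP[_ /negPf].
by rewrite eq_sym => ->.
Qed.

Section InvSign.
Variables (R : pzRingType) (n : nat).

(** Since |w| is injective, exactly one of the two indicators is 1, and it selects the sign that
    decides the comparison. Doubling avoids a division by 2. *)
Lemma inv_indE (w : {perm signed n}) i j : w \in Bset n -> i != j ->
  (inv_ind i j w)%:R *+ 2 =
  1 + ((absfun w j < absfun w i)%N%:R * (-1) ^+ psign w i -
       (absfun w i < absfun w j)%N%:R * (-1) ^+ psign w j) :> R.
Proof.
move=> wB ij; have s : absfun w i != absfun w j.
  by apply: contra_neq ij => /(absfun_inj wB).
rewrite /inv_ind !perm_spos sint_lt //=; move: s; rewrite -val_eqE /=.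
by case: ltngtP => //= _ _; case: psign;
  rewrite /= !(mul0r, mul1r, expr0, expr1, sub0r, subr0, opprK, subrr, mul0rn, mulr2n).
Qed.

End InvSign.

(** * Averages over a conjugation-invariant subset of B_n *)

Section Average.
Variables (R : numFieldType) (n a b : nat) (C : {set {perm signed n}}).
Hypothesis n_ge3 : (3 <= n)%N.
Hypothesis CB : C \subset Bset n.
Hypothesis CJ : forall w g, g \in Bset n -> w \in C -> (w ^ g)%g \in C.
Hypothesis Cpos : forall w, w \in C -> nfix false w = a.
Hypothesis Cneg : forall w, w \in C -> nfix true w = b.

Let CinB w : w \in C -> w \in Bset n. Proof. exact: (subsetP CB). Qed.

(** Stability under [g] and under its inverse makes conjugation a bijection of [C]. *)
Lemma sumCJ (F : {perm signed n} -> R) g : g \in Bset n ->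
  \sum_(w in C) F w = \sum_(w in C) F (w ^ g)%g.
Proof.
move=> gB; rewrite (reindex_inj (conjg_inj g)); apply: eq_bigl => w.
apply/idP/idP; last exact: CJ.
by move/(CJ (groupVr (G := Bgroup n) gB)); rewrite conjgK.
Qed.

Section Perm.
Variable s : 'S_n.
(** The lift of [s] without sign changes: conjugating by it relabels |w| and transports the signs
    unchanged. *)
Let g := signed_perm (fun _ => false) (@perm_inj _ s).
Let gB : g \in Bset n := signed_perm_in _ _.

Let gE k : s k = absfun g k. Proof. by rewrite absfun_signed_perm. Qed.

Lemma absfunJ_perm w i j : w \in C ->
  (absfun (w ^ g)%g (s i) == s j) = (absfun w i == j).
Proof.
by move=> /CinB wB; rewrite !gE absfunJ // (inj_eq (absfun_inj gB)).
Qed.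

Lemma fixsignJ_perm w i : w \in C -> fixsign R (w ^ g)%g (s i) = fixsign R w i.
Proof.
move=> wC; rewrite /fixsign absfunJ_perm // gE psignJ ?(CinB wC) //.
by rewrite !psign_signed_perm addbF.
Qed.

Lemma sum_fixsignJ i : \sum_(w in C) fixsign R w (s i) = \sum_(w in C) fixsign R w i.
Proof. by rewrite (sumCJ _ gB); apply: eq_bigr => w wC; rewrite fixsignJ_perm. Qed.

Lemma sum_fixsign_valJ i j k :
  \sum_(w in C) fixsign R w (s i) * (absfun w (s j) == s k)%:R =
  \sum_(w in C) fixsign R w i * (absfun w j == k)%:R.
Proof.
by rewrite (sumCJ _ gB); apply: eq_bigr => w wC; rewrite fixsignJ_perm // absfunJ_perm.
Qed.

End Perm.

Let D1 : R := a%:R - b%:R.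
Let D2 : R := a%:R ^+ 2 - b%:R ^+ 2.

Let n_neq0 : n%:R != 0 :> R. Proof. by rewrite pnatr_eq0; lia. Qed.
Let n1_neq0 : n%:R - 1 != 0 :> R.
Proof. by rewrite subr_eq0 (eqr_nat _ _ 1); lia. Qed.
Let n2_neq0 : n%:R - 2%:R != 0 :> R.
Proof. by rewrite subr_eq0 eqr_nat; lia. Qed.

(** Transpositions make the sum independent of [i], and summing over all [i] gives [a - b] for each
    [w]. Keeping the factor [#|C|] instead of dividing lets the identity hold for empty [C] too. *)
Lemma mean_fixsign i : \sum_(w in C) fixsign R w i = #|C|%:R * (D1 / n%:R).
Proof.
rewrite mulrA; apply: (canRL (mulfK n_neq0)); rewrite mulr_natr.
rewrite -[n in _ *+ n]card_ord -sumr_const.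
rewrite [LHS](_ : _ = \sum_(k < n) \sum_(w in C) fixsign R w k); last first.
  by apply: eq_bigr => k _; rewrite -(sum_fixsignJ (tperm i k)) tpermL.
rewrite exchange_big /= mulr_natl -sumr_const; apply: eq_bigr => w wC.
by rewrite sum_fixsign Cpos ?Cneg.
Qed.

(** The sum is the same for all n(n-1) ordered pairs of distinct points, and for each [w] the total
    over these pairs is (a - b)(a + b - 1) = [D2 - D1]. *)
Lemma mean_fixsign_fix i j : i != j ->
  \sum_(w in C) fixsign R w i * (absfun w j == j)%:R =
  #|C|%:R * ((D2 - D1) / (n%:R * (n%:R - 1))).
Proof.
move=> ij; rewrite mulrA; apply: (canRL (mulfK _)); first by rewrite mulf_neq0.
set V := \sum_(w in C) _.
transitivity (\sum_(k < n) \sum_(l < n | l != k)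
    \sum_(w in C) fixsign R w k * (absfun w l == l)%:R).
  rewrite [RHS](_ : _ = \sum_(k < n) \sum_(l < n | l != k) V).
    under [RHS]eq_bigr do rewrite sumr_const.
    rewrite [RHS](eq_bigr (fun=> V *+ n.-1)) => [|k _]; last first.
      by congr (_ *+ _); rewrite -[n in RHS]card_ord -(cardC1 k); apply: eq_card.
    rewrite sumr_const card_ord -[V *+ _]mulr_natr -[RHS]mulr_natr -mulrA.
    by congr (_ * _); rewrite mulrC -subn1 natrB //; lia.
  apply: eq_bigr => k _; apply: eq_bigr => l lk.
  (* Two transpositions carry [(i, j)] to [(k, l)]: the first sends [i] to [k], and the second moves
     the image of [j] to [l] while keeping [k]. *)
  have jk : tperm i k j != k by rewrite -[k in _ != k](tpermL i k) inj_eq ?(eq_sym j) //; apply: perm_inj.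
  rewrite /V -(sum_fixsign_valJ (tperm i k) i j j).
  rewrite -(sum_fixsign_valJ (tperm (tperm i k j) l) (tperm i k i)).
  by rewrite !tpermL (tpermD jk lk).
under eq_bigr do rewrite exchange_big /=.
rewrite exchange_big /= mulr_natl -sumr_const; apply: eq_bigr => w wC.
(* Among the [a + b] fixed points, [k] itself is removed; its own term is [fixsign R w k]. *)
have fixE k : \sum_(l < n | l != k) fixsign R w k * (absfun w l == l)%:R =
    fixsign R w k * (a%:R + b%:R - 1).
  apply/eqP; rewrite mulrBr mulr1 eq_sym subr_eq -(Cpos wC) -(Cneg wC) -sum_fix mulr_sumr.
  by rewrite (bigD1 k) //= fixsign_fix addrC.
under eq_bigr do rewrite fixE.
rewrite -mulr_suml sum_fixsign Cpos ?Cneg // /D1 /D2; ring.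
Qed.

(** Transpositions away from [i] and [j] make all n - 2 admissible values [k] equivalent; their
    total is [mean_fixsign] minus the contribution of [j] fixed. *)
Lemma mean_fixsign_val i j k : i != j -> k != i -> k != j ->
  \sum_(w in C) fixsign R w i * (absfun w j == k)%:R =
  #|C|%:R * ((D1 / (n%:R - 1) - D2 / (n%:R * (n%:R - 1))) / (n%:R - 2%:R)).
Proof.
move=> ij ki kj.
rewrite mulrA; apply: (canRL (mulfK n2_neq0)); set U := \sum_(w in C) _.
transitivity (\sum_(l < n | (l != i) && (l != j))
    \sum_(w in C) fixsign R w i * (absfun w j == l)%:R).
  rewrite [RHS](eq_bigr (fun=> U)) => [|l /andP[li lj]]; last first.
    by rewrite /U -(sum_fixsign_valJ (tperm k l) i j k) tpermL !tpermD.
  rewrite sumr_const -[RHS]mulr_natr; congr (_ * _).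
  have -> : #|[pred l : 'I_n | (l != i) && (l != j)]| = (n - 2)%N.
    have := cardsC [set i; j]; rewrite cards2 ij card_ord /= => cardE.
    have -> : #|[pred l : 'I_n | (l != i) && (l != j)]| = #|~: [set i; j]|.
      by apply: eq_card => l; rewrite !inE negb_or.
    by rewrite -[X in (X - _)%N]cardE addKn.
  by rewrite natrB //; lia.
rewrite exchange_big /=.
(* When [i] is fixed, injectivity excludes the value [i] at [j], so the sum over [l] is 1 unless [j]
   is fixed. *)
transitivity (\sum_(w in C) (fixsign R w i - fixsign R w i * (absfun w j == j)%:R)).
  apply: eq_bigr => w wC; rewrite -mulr_sumr -[X in _ = X - _]mulr1 -mulrBr.
  rewrite /fixsign; case: (eqVneq (absfun w i) i) => [wi | _]; last by rewrite !mul0r.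
  congr (_ * _); have nji : absfun w j != i.
    by rewrite -wi (inj_eq (absfun_inj (CinB wC))) eq_sym.
  case: eqVneq => [wj | nwj]; rewrite ?subrr ?subr0.
    by rewrite wj big1 // => l /andP[_ /negPf]; rewrite eq_sym => ->.
  rewrite (bigD1 (absfun w j)) ?nji //= eqxx big1 ?addr0 // => l /andP[_ /negPf].
  by rewrite eq_sym => ->.
rewrite sumrB mean_fixsign mean_fixsign_fix //.
by field; rewrite n_neq0 n1_neq0.
Qed.

Let U := ((D1 / (n%:R - 1) - D2 / (n%:R * (n%:R - 1))) / (n%:R - 2%:R)).
Let V := ((D2 - D1) / (n%:R * (n%:R - 1))).

(** Each value [k] below [i] contributes [U], except that [k = j] contributes [V]. Indices start at
    0, so there are exactly [i] such values. *)
Lemma mean_fixsign_lt i j : i != j ->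
  \sum_(w in C) fixsign R w i * (absfun w j < i)%N%:R =
  #|C|%:R * ((j < i)%N%:R * (V - U) + i%:R * U).
Proof.
move=> ij.
transitivity (\sum_(k < n | (k < i)%N) \sum_(w in C) fixsign R w i * (absfun w j == k)%:R).
  rewrite exchange_big; apply: eq_bigr => w wC /=; rewrite -mulr_sumr; congr (_ * _).
  by rewrite sum_eq_lt.
transitivity (\sum_(k < n | (k < i)%N) #|C|%:R * ((k == j)%:R * (V - U) + U)).
  apply: eq_bigr => k ki; have ki' : k != i by rewrite neq_ltn ki.
  case: (eqVneq k j) => [-> | kj]; first by rewrite mean_fixsign_fix // mul1r subrK.
  by rewrite mean_fixsign_val // mul0r add0r.
rewrite -mulr_sumr big_split /= -mulr_suml; congr (_ * (_ * _ + _)).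
  by rewrite -sum_eq_lt; apply: eq_bigr => k _; rewrite eq_sym.
rewrite sumr_const -[LHS]mulr_natl; congr (_%:R * _).
rewrite -sum1_card -(big_ord_widen_cond n xpredT (fun=> 1%N)) ?sum1_card ?card_ord //.
exact: ltnW.
Qed.

(* If i is not fixed by |w|, conjugation by the sign change at i flips the sign of
   w i and keeps |w|, so only the fixed i contribute. *)
Lemma sum_sign_lt i j :
  \sum_(w in C) (absfun w j < absfun w i)%N%:R * (-1) ^+ psign w i =
  \sum_(w in C) fixsign R w i * (absfun w j < i)%N%:R.
Proof.
pose g := signed_perm (fun k => k == i) (@inj_id _).
have gB : g \in Bset n by apply: signed_perm_in.
have gE k : absfun g k = k by rewrite absfun_signed_perm.
pose F w : R := (absfun w i != i)%:R * ((absfun w j < absfun w i)%N%:R * (-1) ^+ psign w i).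
have F0 : \sum_(w in C) F w = 0.
  suff /eqP : \sum_(w in C) F w = - \sum_(w in C) F w.
    by rewrite -addr_eq0 -mulr2n mulrn_eq0 => /eqP.
  rewrite {1}(sumCJ _ gB) -sumrN; apply: eq_bigr => w wC; rewrite /F.
  have aE k : absfun (w ^ g)%g k = absfun w k by rewrite -{1}(gE k) absfunJ ?(CinB wC) // gE.
  rewrite !aE; case: eqVneq => [|wi]; first by rewrite !mul0r oppr0.
  have -> : psign (w ^ g)%g i = ~~ psign w i.
    by rewrite -{1}(gE i) psignJ ?(CinB wC) // !psign_signed_perm eqxx (negPf wi) addbF.
  by rewrite -mulrN -mulrN signrN.
rewrite -[RHS]addr0 -[X in _ = _ + X]F0 -big_split /=; apply: eq_bigr => w wC; rewrite /F /fixsign.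
by case: eqVneq => [->|_]; rewrite !(mul0r, mul1r, add0r, addr0) // mulrC.
Qed.

(** In the difference of the two sign terms, the value [i] taken at [i] leaves [V], and each of the
    j - i - 1 values strictly between [i] and [j] leaves [U]; this is the source of the weight in
    beta. *)
Lemma mean_inv (i j : 'I_n) : (i < j)%N ->
  \sum_(w in C) (inv_ind i j w)%:R =
  #|C|%:R * (1 / 2%:R - V / 2%:R - (j%:R - i%:R - 1) * U / 2%:R).
Proof.
move=> ij; have nij : i != j by rewrite neq_ltn ij.
suff : (\sum_(w in C) (inv_ind i j w)%:R) *+ 2 =
    #|C|%:R * (1 - V - (j%:R - i%:R - 1) * U) :> R.
  by rewrite -mulr_natr => /(canRL (mulfK _)) -> //; [field | rewrite pnatr_eq0].
rewrite -sumrMnl; under eq_bigr => w wC do rewrite (inv_indE _ (CinB wC) nij).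
rewrite big_split /= sumrB !sum_sign_lt !mean_fixsign_lt // 1?eq_sym //.
rewrite ij ltnNge ltnW //= sumr_const; ring.
Qed.

End Average.

(** * Fixed points as parts equal to 1 *)

Lemma count_parts1 (T : finType) (A : {set {set T}}) :
  count_mem 1 (sort geq [seq #|c| | c : {set T} in A]) =
  #|[set c in A | #|c| == 1]|.
Proof.
have /seq.permP -> := permEl (perm_sort geq [seq #|c| | c : {set T} in A]).
rewrite count_map cardE -size_filter /enum_mem -filter_predI.
by congr size; apply: eq_filter => c; rewrite /= inE andbC.
Qed.

(** A one-element cycle is a fixed point of |w|, and its parity is the sign of [w] there. *)
Lemma nfixE n (w : {perm signed n}) b :
  nfix b w = #|[set c in cycles w | (#|c| == 1)%N && (odd_cycle w c == b)]|.
Proof.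
rewrite /nfix -(card_imset _ set1_inj); apply: eq_card => c; rewrite [RHS]inE.
have odd1 i : odd_cycle w [set i] = psign w i by rewrite odd_cycleE big_set1.
apply/imsetP/and3P => [[i] | [/imsetP[i _ ->] /cards1P[j cj]]].
  rewrite inE => /andP[/eqP wi wb] ->; rewrite cards1 odd1; split=> //.
  apply/imsetP; exists i => //; apply/setP => j; rewrite !inE -fconnect_orbit.
  apply/eqP/idP => [-> //| /iter_findex <-].
  by elim: (findex _ _ _) => //= k ->.
have /set1P ij : i \in [set j] by rewrite -cj inE -fconnect_orbit connect0.
have /set1P wj : absfun w i \in [set j] by rewrite -cj inE -fconnect_orbit fconnect1.
by rewrite cj odd1 => wb; exists j => //; rewrite inE wb andbT -ij wj ij.
Qed.

Lemma nfix_Cclass n (p : bipartition n) w : w \in Cclass p ->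
  nfix false w = nparts 1 (bpl p) /\ nfix true w = nparts 1 (bpr p).
Proof.
rewrite in_Cclass => /andP[_ /eqP[<- <-]].
rewrite /nparts !count_parts1 !nfixE; split; apply: eq_card => c; rewrite !inE.
  by rewrite eqbF_neg -andbA (andbC (~~ _)).
by rewrite eqb_id -andbA (andbC (odd_cycle _ _)).
Qed.

(** * Realizing every bi-partition as a cycle type *)

Section Blocks.
Variables (T : eqType) (ss : seq (seq T)).
Hypothesis ss_uniq : uniq (flatten ss).

Definition block (x : T) : seq T := nth [::] ss (find (fun c => x \in c) ss).

Lemma block_in c x : c \in ss -> x \in c -> block x = c.
Proof.
rewrite /block; elim: ss ss_uniq => //= d s IHs.
rewrite cat_uniq => /and3P[_ /hasPn ds us]; rewrite inE => /predU1P[-> -> //| cs xc].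
have xs : x \in flatten s by apply/flattenP; exists c.
by rewrite (negPf (ds _ xs)) /= IHs.
Qed.

Lemma block_uniq c : c \in ss -> uniq c.
Proof.
elim: ss ss_uniq => //= d s IHs; rewrite cat_uniq => /and3P[ud _ us].
by rewrite inE => /predU1P[-> //| /IHs]; apply.
Qed.

End Blocks.

(** Disjoint blocks could give the same set only if both were empty. *)
Lemma uniq_map_blocks (T : finType) (ss : seq (seq T)) :
  uniq (flatten ss) -> [::] \notin ss ->
  uniq [seq [set x in c] | c : seq T <- ss].
Proof.
elim: ss => //= c ss IHs; rewrite cat_uniq inE negb_or.
case/and3P => _ /hasPn css us /andP[c0 ss0]; rewrite IHs // andbT.
apply/mapP => -[d dss /setP cd]; case: c c0 css cd => // x c _ css cd.
have xd : x \in d by have := cd x; rewrite !inE eqxx => /esym.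
by have /css : x \in flatten ss; [apply/flattenP; exists d | rewrite /= inE eqxx].
Qed.

Section Realize.
Variables (n : nat) (ss1 ss2 : seq (seq 'I_n)).
Let ss := ss1 ++ ss2.
Hypothesis ss_uniq : uniq (flatten ss).
Hypothesis ss_full : forall x, x \in flatten ss.
Hypothesis ss_pos : [::] \notin ss.

(** Each block is rotated cyclically, so that the blocks become the cycles. *)
Let rot (x : 'I_n) := next (block ss x) x.

Let rotE c x : c \in ss -> x \in c -> rot x = next c x.
Proof. by move=> cs xc; rewrite /rot (block_in ss_uniq cs xc). Qed.

Let rot_inj : injective rot.
Proof.
move=> x y; have /flattenP[c cs xc] := ss_full x; have /flattenP[d ds yd] := ss_full y.
rewrite (rotE cs xc) (rotE ds yd) => xy.
(* [next] stays inside its block, so equal images force equal blocks by disjointness; within a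
   block, [prev] inverts [next]. *)
have cd : c = d.
  rewrite -(block_in ss_uniq cs (x := next c x)) ?mem_next //.
  by rewrite xy (block_in ss_uniq ds) ?mem_next.
by move: xy; rewrite cd => /(can_inj (prev_next (block_uniq ss_uniq ds))).
Qed.

(* One sign change in each block of ss2, at its head, makes these cycles odd. *)
Let sg (x : 'I_n) := has (fun c => ohead c == Some x) ss2.

Definition realize : {perm signed n} := signed_perm sg rot_inj.

Lemma realize_orbit c x : c \in ss -> x \in c ->
  [set y in fingraph.orbit (absfun realize) x] = [set y in c].
Proof.
move=> cs xc; apply/setP => y; rewrite !inE -fconnect_orbit.
apply: (fconnect_cycle (p := c)) => //.
apply: (sub_in_cycle (P := mem c)) (cycle_next (block_uniq ss_uniq cs)); last exact/allP.
by move=> u v uc vc /eqP <-; rewrite /= absfun_signed_perm (rotE cs).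
Qed.

Lemma cycles_realize : cycles realize =i [seq [set y in c] | c : seq 'I_n <- ss].
Proof.
move=> X; apply/imsetP/mapP => [[x _ ->] | [c cs ->]].
  by have /flattenP[c cs xc] := ss_full x; exists c; rewrite ?(realize_orbit cs).
case: c cs => [|x c] cs; first by case/negP: ss_pos.
by exists x; rewrite ?(realize_orbit cs) ?mem_head.
Qed.

Lemma odd_realize2 c : c \in ss2 -> odd_cycle realize [set y in c].
Proof.
move=> cs2; have cs : c \in ss by rewrite mem_cat cs2 orbT.
rewrite odd_cycleE -odd_card_addb.
case: c cs2 cs => [|x c] cs2 cs; first by case/negP: ss_pos.
(* A negative sign at [y] makes [y] the head of a block of [ss2]; by disjointness this block is
   [x :: c], so [y] is [x]. *)
rewrite (_ : [set _ in _ | _] = [set x]) ?cards1 //; apply/setP => y.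
rewrite !inE psign_signed_perm; apply/andP/eqP => [[yc /hasP[d ds2]] | ->].
  case: d ds2 => //= z d ds2 /eqP[zy]; rewrite {z}zy in ds2.
  have ds : y :: d \in ss by rewrite mem_cat ds2 orbT.
  have := block_in ss_uniq ds (mem_head y d).
  by rewrite (block_in ss_uniq cs) ?inE // => -[].
by rewrite eqxx; split=> //; apply/hasP; exists (x :: c) => /=.
Qed.

Lemma odd_realize1 c : c \in ss1 -> ~~ odd_cycle realize [set y in c].
Proof.
move=> cs1; rewrite odd_cycleE big1 // => y; rewrite inE psign_signed_perm => yc.
apply/negbTE/hasPn => -[|z d] //= ds2; apply: contraTneq ss_uniq => -[zy].
rewrite /ss flatten_cat cat_uniq negb_and negb_and negbK; apply/orP; right; apply/orP; left.
apply/hasP; exists y; last by apply/flattenP; exists c.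
by apply/flattenP; exists (z :: d); rewrite // zy mem_head.
Qed.

Lemma perm_parts_realize (s : seq (seq 'I_n)) (A : {set {set 'I_n}}) :
  {subset s <= ss} -> uniq [seq [set y in c] | c : seq 'I_n <- s] ->
  A =i [seq [set y in c] | c : seq 'I_n <- s] ->
  perm_eq [seq #|c| | c : {set 'I_n} in A] (shape s).
Proof.
move=> s_ss us AE; apply: (@perm_trans _ (map (fun c : {set 'I_n} => #|c|)
  [seq [set y in c] | c : seq 'I_n <- s])).
  by apply: perm_map; apply: uniq_perm; rewrite ?enum_uniq // => X; rewrite mem_enum AE.
rewrite -map_comp (_ : map _ s = shape s) //; apply/eq_in_map => c cs /=.
by rewrite cardsE; apply/card_uniqP/(block_uniq ss_uniq)/s_ss.
Qed.

Lemma cycle_type_realize : sorted geq (shape ss1) -> sorted geq (shape ss2) ->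
  cycle_type realize = (shape ss1, shape ss2).
Proof.
have geq_tr : transitive geq by move=> a b c /=; lia.
have [u1 u2] : uniq [seq [set y in c] | c : seq 'I_n <- ss1] /\
               uniq [seq [set y in c] | c : seq 'I_n <- ss2].
  have := uniq_map_blocks ss_uniq ss_pos.
  by rewrite map_cat cat_uniq => /and3P[].
move=> s1 s2; rewrite -(sorted_sort geq_tr s1) -(sorted_sort geq_tr s2) /cycle_type.
congr pair; apply: perm_sort_geq; apply: perm_parts_realize => //.
- by move=> c cs; rewrite mem_cat cs.
- move=> X; rewrite inE cycles_realize; apply/andP/mapP => [[/mapP[c cs ->]] | [c cs ->]].
    move: cs; rewrite mem_cat => /orP[cs _ | /odd_realize2 -> //]; by exists c.
  by rewrite odd_realize1 // map_f // mem_cat cs.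
- by move=> c cs; rewrite mem_cat cs orbT.
- move=> X; rewrite inE cycles_realize; apply/andP/mapP => [[/mapP[c cs ->]] | [c cs ->]].
    move: cs; rewrite mem_cat => /orP[/odd_realize1/negPf -> //| cs _]; by exists c.
  by rewrite odd_realize2 // map_f // mem_cat cs orbT.
Qed.

End Realize.

(** The enumeration of [n] is cut into consecutive blocks whose lengths are the parts; those coming
    from [bpl p] become even cycles, the others odd ones. *)
Lemma Cclass_neq0 n (p : bipartition n) : Cclass p != set0.
Proof.
have /and3P[/andP[sl l0] /andP[sr r0] /eqP pn] := valP p.
rewrite -/(bpl p) -/(bpr p) in sl l0 sr r0 pn.
pose sh := bpl p ++ bpr p; pose ss := reshape sh (enum 'I_n).
have shn : sumn sh = size (enum 'I_n) by rewrite sumn_cat pn size_enum_ord.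
have fE : flatten ss = enum 'I_n by rewrite reshapeKr ?shn.
have shE : shape ss = sh by rewrite reshapeKl ?shn.
pose k := size (bpl p); have ssE : take k ss ++ drop k ss = ss := cat_take_drop k ss.
have sE1 : shape (take k ss) = bpl p.
  by rewrite /shape map_take -/(shape ss) shE take_size_cat.
have sE2 : shape (drop k ss) = bpr p.
  by rewrite /shape map_drop -/(shape ss) shE drop_size_cat.
have us : uniq (flatten (take k ss ++ drop k ss)) by rewrite ssE fE enum_uniq.
have fs x : x \in flatten (take k ss ++ drop k ss) by rewrite ssE fE mem_enum.
(* An empty block would be a part equal to 0, which [is_partition] forbids. *)
have ps : [::] \notin take k ss ++ drop k ss.
  rewrite ssE; apply: contra (_ : 0%N \notin sh); last by rewrite mem_cat negb_or l0.
  by rewrite -shE => /(map_f size).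
apply/set0Pn; exists (realize us fs); rewrite in_Cclass signed_perm_in /=.
by rewrite cycle_type_realize ?sE1 ?sE2.
Qed.

(** * Expectations of the weighted inversion statistic *)

Section Expectation.
Variables (R : realType) (n : nat) (wt : 'I_n -> 'I_n -> R).

(** By linearity, a mean affine in j - i - 1 has its constant term weighted by alpha and its slope
    by beta. *)
Lemma expect_Xwt (C : {set {perm signed n}}) (x y : R) : C != set0 ->
  (forall i j : 'I_n, (i < j)%N ->
     \sum_(w in C) (inv_ind i j w)%:R = #|C|%:R * (x + (j%:R - i%:R - 1) * y) :> R) ->
  expect_unif C (Xwt wt) = alphawt wt * x + betawt wt * y.
Proof.
move=> C0 meanC; have nz : #|C|%:R != 0 :> R by rewrite pnatr_eq0 cards_eq0.
apply: (canLR (mulfK nz)); rewrite /Xwt exchange_big /=.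
rewrite /alphawt /betawt !mulr_suml -big_split mulr_suml /=; apply: eq_bigr => i _.
rewrite exchange_big /= !mulr_suml -big_split mulr_suml /=; apply: eq_bigr => j ij.
by rewrite -mulr_sumr meanC //; ring.
Qed.

(* Multiplying by -1 in B_n exchanges inversions and non-inversions of i < j. *)
Lemma mean_inv_Bgroup (i j : 'I_n) : (i < j)%N ->
  \sum_(w in Bgroup n) (inv_ind i j w)%:R = #|Bgroup n|%:R * (1 / 2%:R) :> R.
Proof.
move=> ij; have nij : i != j by rewrite neq_ltn ij.
pose g := signed_perm (fun=> true) (@inj_id 'I_n).
have gB : g \in Bgroup n by apply: signed_perm_in.
suff : (\sum_(w in Bgroup n) (inv_ind i j w)%:R) *+ 2 = #|Bgroup n|%:R :> R.
  by rewrite mul1r -[_ *+ 2]mulr_natr => /(canRL (mulfK _)) -> //; rewrite pnatr_eq0.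
rewrite mulr2n {2}(reindex_inj (mulIg g)) /=.
rewrite [X in _ + X](eq_bigl (mem (Bgroup n))) => [|w]; last by rewrite /= groupMr.
rewrite -big_split /= -sumr_const; apply: eq_bigr => w wB.
have nwij : absfun w i != absfun w j by rewrite (inj_eq (absfun_inj wB)).
rewrite /inv_ind !permM !perm_spos !permE /signed_fun /= !sint_lt //= !addbT.
by move: nwij; rewrite -val_eqE /=; case: ltngtP => //= _ _; case: psign;
  rewrite /= ?addr0 ?add0r.
Qed.

Lemma expect_Bgroup : expect_unif (Bgroup n) (Xwt wt) = alphawt wt / 2%:R.
Proof.
rewrite (@expect_Xwt _ (1 / 2%:R) 0) ?mulr0 ?addr0 ?mul1r //.
  by apply/set0Pn; exists 1%g; apply: group1.
by move=> i j ij; rewrite mulr0 addr0 mean_inv_Bgroup ?mul1r.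
Qed.

Hypothesis n_ge3 : (3 <= n)%N.

Lemma expect_Cclass (p : bipartition n) :
  expect_unif (Cclass p) (Xwt wt) =
    alphawt wt / 2%:R *
      (1 + (Delta R 1 p - Delta R 2 p) / (n%:R * (n%:R - 1)))
    - betawt wt / (2%:R * (n%:R - 2%:R)) *
      (Delta R 1 p / (n%:R - 1) - Delta R 2 p / (n%:R * (n%:R - 1))).
Proof.
have n0 : n%:R != 0 :> R by rewrite pnatr_eq0; lia.
have n1 : n%:R - 1 != 0 :> R by rewrite subr_eq0 (eqr_nat _ _ 1); lia.
have n2 : n%:R - 2%:R != 0 :> R by rewrite subr_eq0 eqr_nat; lia.
(* [V] and [U] are the class averages of the sign at a fixed [i] when another point is fixed,
   respectively sent to a given third point. *)
pose V := (Delta R 2 p - Delta R 1 p) / (n%:R * (n%:R - 1)).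
pose U := (Delta R 1 p / (n%:R - 1) - Delta R 2 p / (n%:R * (n%:R - 1))) / (n%:R - 2%:R).
rewrite (@expect_Xwt _ (1 / 2%:R - V / 2%:R) (- (U / 2%:R))) ?Cclass_neq0 //.
  by rewrite /U /V; field; rewrite n0 n1 n2.
move=> i j ij; rewrite (@mean_inv R n (nparts 1 (bpl p)) (nparts 1 (bpr p)) (Cclass p)) //.
- by rewrite /U /V /Delta !expr1; congr (_ * _); ring.
- by apply/subsetP => w; rewrite in_Cclass => /andP[].
- by move=> w g; apply: CclassJ.
- by move=> w /nfix_Cclass[].
- by move=> w /nfix_Cclass[].
Qed.

End Expectation.

(** * Exchanging the two partitions *)

Section Swap.
Variable n : nat.

Lemma is_bipartition_swap (p : bipartition n) :
  is_bipartition ((val p).2, (val p).1).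
Proof. by have /and3P[pl pr pn] := valP p; rewrite /is_bipartition pl pr addnC. Qed.

Definition swap_bipartition (p : bipartition n) : bipartition n :=
  Sub ((val p).2, (val p).1) (is_bipartition_swap p).

Lemma swap_bipartitionK : involutive swap_bipartition.
Proof. by move=> p; apply: val_inj; rewrite /= -surjective_pairing. Qed.

(** The exchange permutes the bi-partitions, preserves [zbipart] and negates [F], so the sum equals
    its own opposite. *)
Lemma sum_antisym_bipartition (R : numFieldType) (F : nat -> nat -> R) :
  (forall a b, F b a = - F a b) ->
  \sum_(p : bipartition n)
     (zbipart p)%:R^-1 * F (nparts 1 (bpl p)) (nparts 1 (bpr p)) = 0.
Proof.
move=> Fanti; set S := LHS; suff /eqP : S = - S.
  by rewrite -addr_eq0 -mulr2n mulrn_eq0 => /eqP.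
rewrite {1}/S (reindex_inj (can_inj swap_bipartitionK)) -sumrN.
apply: eq_bigr => p _; rewrite -mulrN -Fanti; congr (_%:R^-1 * _).
by rewrite /zbipart -[LHS]mulnA [LHS]mulnC [LHS]mulnA.
Qed.

End Swap.

Theorem theorem4p10 (R : realType) (n : nat) (hn : (3 <= n)%N)
    (wt : 'I_n -> 'I_n -> R) :
  [/\ (forall p q : bipartition n,
         nparts 1 (bpl p) = nparts 1 (bpl q) ->
         nparts 1 (bpr p) = nparts 1 (bpr q) ->
         expect_unif (Cclass p) (Xwt wt) = expect_unif (Cclass q) (Xwt wt)),
      (forall p : bipartition n,
         expect_unif (Cclass p) (Xwt wt) =
           alphawt wt / 2%:R *
             (1 + (Delta R 1 p - Delta R 2 p) / (n%:R * (n%:R - 1)))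
           - betawt wt / (2%:R * (n%:R - 2%:R)) *
             (Delta R 1 p / (n%:R - 1) - Delta R 2 p / (n%:R * (n%:R - 1)))),
      expect_unif (Bgroup n) (Xwt wt) = alphawt wt / 2%:R
    & exists f : {mpoly R[2]},
        [/\ (msize f <= 3)%N,
            (forall p : bipartition n,
               expect_unif (Cclass p) (Xwt wt) =
                 expect_unif (Bgroup n) (Xwt wt)
                 + f.@[pt2 (nparts 1 (bpl p))%:R (nparts 1 (bpr p))%:R])
          & \sum_(p : bipartition n)
              (zbipart p)%:R^-1
              * f.@[pt2 (nparts 1 (bpl p))%:R (nparts 1 (bpr p))%:R] = 0]].
Proof.
split; [|exact: expect_Cclass|exact: expect_Bgroup|].
  by move=> p q pq1 pq2; rewrite !expect_Cclass // /Delta pq1 pq2.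
have n0 : n%:R != 0 :> R by rewrite pnatr_eq0; lia.
have n1 : n%:R - 1 != 0 :> R by rewrite subr_eq0 (eqr_nat _ _ 1); lia.
have n2 : n%:R - 2%:R != 0 :> R by rewrite subr_eq0 eqr_nat; lia.
pose A := alphawt wt / 2%:R; pose B := betawt wt / (2%:R * (n%:R - 2%:R)).
(* [c1] and [c2] are the coefficients of Delta^1 and Delta^2 once the formula is regrouped. *)
pose c1 := A / (n%:R * (n%:R - 1)) - B / (n%:R - 1).
pose c2 := (B - A) / (n%:R * (n%:R - 1)).
pose x0 : {mpoly R[2]} := 'X_ord0; pose x1 : {mpoly R[2]} := 'X_ord_max.
pose f := c1 *: (x0 - x1) + c2 *: (x0 ^+ 2 - x1 ^+ 2).
have fE (a b : R) : f.@[pt2 a b] = c1 * (a - b) + c2 * (a ^+ 2 - b ^+ 2).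
  by rewrite /f mevalD !mevalZ !mevalB !expr2 !mevalM !mevalXU.
have sizeB (p q : {mpoly R[2]}) c : (msize p <= 3 -> msize q <= 3 ->
    msize (c *: (p - q)) <= 3)%N.
  move=> p3 q3; apply: leq_trans (msizeZ_le _ _) (leq_trans (mmeasureD_le _ _ _) _).
  by rewrite mmeasureN geq_max p3.
exists f; split.
(* [msize] is the degree plus one, so the bound 3 expresses degree at most 2. *)
- apply: leq_trans (mmeasureD_le _ _ _) _; rewrite geq_max.
  by rewrite !sizeB // /x0 /x1 ?mpolyXn msizeX ?mdegMn ?mdeg1.
- move=> p; rewrite fE expect_Cclass // expect_Bgroup /Delta /c1 /c2 /A /B !expr1.
  by field; rewrite n0 n1 n2.
- under eq_bigr do rewrite fE.
  (* Both differences in [f] change sign when its variables are exchanged. *)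
  apply: (@sum_antisym_bipartition n R (fun a b =>
    c1 * (a%:R - b%:R) + c2 * (a%:R ^+ 2 - b%:R ^+ 2))) => a b; ring.
Qed.
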